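(* Let $\epsilon>0$ be a constant. There is a constant $C$ (depending only on $\epsilon$) such that for $(G,c)$ sampled from $\mathcal{G}\big(n,p=\frac{2-\epsilon}{n},2\big)$, with vertex set $V$, w.h.p. the following holds: for any two vertex colorings $\sigma$ and $\tau$ adapted to $c$ there exists a sequence $\sigma=\sigma_1,\sigma_2,\dots,\sigma_l=\tau$ of vertex colorings, each adapted to $c$, such that for all $i<l$ $$\left|\{v\in V\mid \sigma_i(v)\neq\sigma_{i+1}(v)\}\right|\le C\log n .$$
   Context: For a finite simple graph $G=(V,E)$ with a (not necessarily proper) edge coloring $c:E\to\{red,blue\}$, a vertex coloring $\sigma:V\to\{red,blue\}$ is adapted to $c$ if for every edge $uv\in E$ either $\sigma(u)\neq c(uv)$ or $\sigma(v)\ne c(uv)$. $\mathcal{G}(n,p,2)$ is the random pair $(G,c)$ in which each possible edge on $n$ labelled vertices is included independently with probability $p\in[0,1]$, and each included edge is independently assigned a uniformly random color from $\{red,blue\}$. A sequence of events $A_n$ occurs w.h.p. if $\mathbb{P}[A_n]\to 1$ as $n\to\infty$. *)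

(* Defs.v *)
From HB Require Import structures.
From mathcomp Require Import all_boot all_order all_algebra.
From mathcomp Require Import all_classical all_reals all_analysis.
Set Implicit Arguments.
Unset Strict Implicit.
Unset Printing Implicit Defensive.
Import Order.TTheory GRing.Theory Num.Theory.
Import numFieldNormedType.Exports.
Local Open Scope ring_scope.

(* The two colors: true is red, false is blue. *)
Notation color := bool.

Definition vpair (V : finType) := {e : {set V} | #|e| == 2%N}.

(* A finite simple graph on V together with an edge coloring: a pair of
   vertices is mapped to None if it is not an edge, and to Some k if it is an
   edge of color k. *)
Definition ecgraph (V : finType) := {ffun vpair V -> option color}.

Definition vcoloring (V : finType) := {ffun V -> color}.

Definition adapted (V : finType) (g : ecgraph V) (s : vcoloring V) : Prop :=
  forall (e : vpair V) (u v : V) (k : color),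
    val e = [set u; v] -> g e = Some k -> s u <> k \/ s v <> k.

Definition disagree (V : finType) (s t : vcoloring V) : {set V} :=
  [set v | s v != t v].

(* The sequence sigma_1, ..., sigma_l is s :: q. *)
Definition adapted_walk (R : realType) (V : finType) (g : ecgraph V) (B : R)
    (s t : vcoloring V) : Prop :=
  exists q : seq (vcoloring V),
    [/\ last s q = t,
        forall r, r \in s :: q -> adapted g r
      & path (fun r r' => #|disagree r r'|%:R <= B) s q].

Definition pair_law (R : realType) (p : R) (o : option color) : R :=
  if o is Some _ then p * 2^-1 else 1 - p.

(* Point mass of the random pair (G, c) of G(n, p, 2): the states of the
   distinct pairs of vertices are independent.  No bound on p is built in: Pr_Gnp2
   is a probability when 0 <= p <= 1, and also when n <= 1, since p is then
   unused. *)
Definition Gnp2 (R : realType) (n : nat) (p : R) (g : ecgraph 'I_n) : R :=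
  \prod_(e : vpair 'I_n) pair_law p (g e).

Definition Pr_Gnp2 (R : realType) (n : nat) (p : R)
    (A : ecgraph 'I_n -> Prop) : R :=
  \sum_(g : ecgraph 'I_n | `[< A g >]) Gnp2 p g.

Lemma Gnp2_ge0 (R : realType) (n : nat) (p : R) (g : ecgraph 'I_n) :
  0 <= p <= 1 -> 0 <= Gnp2 p g.
Proof.
case/andP=> p0 p1; apply: prodr_ge0 => e _; rewrite /pair_law.
by case: (g e) => [_|]; rewrite ?subr_ge0 // mulr_ge0 // invr_ge0.
Qed.

Lemma Pr_Gnp2_setT (R : realType) (n : nat) (p : R) :
  Pr_Gnp2 p (fun _ : ecgraph 'I_n => True) = 1.
Proof.
rewrite /Pr_Gnp2 (eq_bigl predT); last by move=> g; rewrite asboolT.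
rewrite /Gnp2 -(bigA_distr_bigA (fun _ o => pair_law p o)) big1 // => e _.
rewrite (bigD1 None) //= (bigD1 (Some true)) //= (bigD1 (Some false)) //=.
rewrite big1 => [|[[]|]] //; rewrite addr0 -mulrDr.
have -> : 2^-1 + 2^-1 = 1 :> R by rewrite [RHS]splitr mul1r.
by rewrite mulr1 subrK.
Qed.

Definition whp_Gnp2 (R : realType) (p : nat -> R)
    (A : forall n : nat, ecgraph 'I_n -> Prop) : Prop :=
  (Pr_Gnp2 (p n) (A n) @[n --> \oo] --> (1 : R))%classic.

(* Main.v *)
(* Coloring u with k forces every w joined to u by an edge of color k to have
   the other color, and so on.  If t is adapted, the set forced by giving v its
   t-color is consistent with t, so recoloring it as in t keeps a coloring
   adapted; doing this at a vertex where s and t differ moves s closer to t.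
   It remains to see that all forced sets have size O(log n).  Each step of
   the exploration of such a set discovers at most Bin(n, p / 2) vertices, of
   mean 1 - d with d = eps / 2, through edges not
   examined before; hence E[z^size] <= y for y = 1 + d and z = 1 + d^3 > 1, as
   z exp((1 - d) d) <= y.  Markov's inequality with z^(C ln n) = n^2 and a union
   bound over the 2n pairs (v, k) conclude. *)

Require Import Defs.
From mathcomp Require Import all_boot all_order all_algebra.
From mathcomp Require Import all_classical all_reals all_analysis.
From mathcomp Require Import zify ring lra.
Set Implicit Arguments.
Unset Strict Implicit.
Unset Printing Implicit Defensive.
Import Order.TTheory GRing.Theory Num.Theory.
Import numFieldNormedType.Exports.
Local Open Scope ring_scope.

(** * Forced sets and walks between adapted colorings, for a fixed graph *)

Section ForcedSet.
Variable V : finType.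
Implicit Types (g h : ecgraph V) (U : {set V}) (s : seq (V * color)).

Definition cnbrs g (u : V) (k : color) U : {set V} :=
  [set w in U | [exists e : vpair V, (val e == [set u; w]) && (g e == Some k)]].

(* [s] lists the colored vertices that remain to be processed, and [U] is the
   set of vertices not reached so far; [#|U| + size s] drops by one at each
   step, so this much fuel suffices. *)
Fixpoint explore (fuel : nat) g U s : {set V} :=
  if fuel isn't f.+1 then finset.set0 else
  if s isn't (u, k) :: s' then finset.set0 else
  let X := cnbrs g u k U in
  u |: explore f g (U :\: X) (s' ++ [seq (w, ~~ k) | w <- enum X]).

(** The fuel is exact: [#|V| - 1] unreached vertices and one queued vertex. *)
Definition forced g (v : V) (k : color) : {set V} :=
  explore #|V| g [set~ v] [:: (v, k)].

Lemma cnbrs_sub g u k U : cnbrs g u k U \subset U.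
Proof. by apply/fintype.subsetP => w; rewrite finset.inE => /andP[]. Qed.

Lemma unzip1_cat_map s (k : color) (X : {set V}) :
  unzip1 (s ++ [seq (w, k) | w <- enum X]) = unzip1 s ++ enum X.
Proof. by rewrite /unzip1 map_cat -map_comp map_id. Qed.

Lemma explore_measure U (X : {set V}) s (p : V * color) (k : color) : X \subset U ->
  (#|U| + size (p :: s) =
   (#|U :\: X| + size (s ++ [seq (w, k) | w <- enum X])).+1)%N.
Proof.
move=> XU; rewrite size_cat size_map -cardE finset.cardsD (finset.setIidPr XU) /=.
by have := fintype.subset_leq_card XU; lia.
Qed.

(** Adaptedness of [t] makes every newly queued color agree with [t], so the hypothesis on the queue
    survives each step. The exception for [w] outside [U] and the queue allows for vertices
    processed before the call. *)
Lemma explore_closed (t : vcoloring V) g (f : nat) U s :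
  adapted g t -> (#|U| + size s <= f)%N ->
  (forall x, x \in s -> t x.1 = x.2) ->
  {subset unzip1 s <= explore f g U s} /\
  (forall (e : vpair V) (x w : V), x \in explore f g U s ->
     val e = [set x; w] -> g e = Some (t x) ->
     [|| w \in explore f g U s | w \notin [predU U & unzip1 s]]).
Proof.
move=> gt; elim: f U s => [|f IH] U [|[u k] s] //=.
- by move=> _ _; split=> [w|e x w]; rewrite ?in_nil ?finset.inE.
- by rewrite addnS.
- by move=> _ _; split=> [w|e x w]; rewrite ?in_nil ?finset.inE.
set X := cnbrs g u k U; set s' := s ++ _.
have XU : X \subset U by exact: cnbrs_sub.
move=> szf ts.
have tu : t u = k by exact: (ts (u, k) (mem_head _ _)).
have tX w : (w \in U) -> (exists2 e, val e = [set u; w] & g e = Some k) -> w \in X.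
  move=> wU [e ew ek]; rewrite finset.inE wU; apply/existsP; exists e.
  by rewrite ew ek !eqxx.
have [] := IH (U :\: X) s'.
- by move: szf; rewrite -/(size ((u, k) :: s)) (explore_measure s (u, k) (~~ k) XU).
- move=> x; rewrite mem_cat => /orP[xs|]; first by apply: ts; rewrite in_cons xs orbT.
  case/mapP => w; rewrite mem_enum finset.inE => /andP[_ /existsP[e]].
  move=> /andP[/eqP ew /eqP ek] -> /=.
  by have := gt e u w k ew ek; case: (t w) (k) tu => -[] -> [].
set Z := explore _ _ _ _ => sZ clZ; split.
  move=> x; rewrite in_cons => /predU1P[->|xs]; first by rewrite finset.setU11.
  by rewrite finset.in_setU1 sZ ?orbT // unzip1_cat_map mem_cat xs.
move=> e x w; rewrite 2!finset.in_setU1 => xZ ew ek.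
have [//|wu /=] := eqVneq w u; have [//|wZ /=] := boolP (w \in Z).
have ws : w \notin unzip1 s' by apply: contra wZ; exact: sZ.
move: (ws); rewrite unzip1_cat_map mem_cat mem_enum negb_or => /andP[ws1 wX].
have [xu|xu] := eqVneq x u.
  rewrite !finset.inE (negPf ws1) (negPf wu) !orbF; apply: contra wX => wU.
  by apply: tX => //; exists e; rewrite -?xu // ek xu tu.
move: xZ; rewrite (negPf xu) /= => xZ.
have := clZ e x w xZ ew ek; rewrite (negPf wZ) /= !finset.inE (negPf ws) orbF /=.
by move: wX; rewrite finset.inE => -> /=; rewrite (negPf ws1) (negPf wu) !orbF.
Qed.

(** Initially every vertex is in [U] or in the queue, so the exception in [explore_closed] is
    void. *)
Lemma forced_closed g (t : vcoloring V) (v : V) : adapted g t ->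
  v \in forced g v (t v) /\
  (forall (e : vpair V) (x w : V), x \in forced g v (t v) ->
     val e = [set x; w] -> g e = Some (t x) -> w \in forced g v (t v)).
Proof.
move=> gt; have [||sub cl] := @explore_closed t g #|V| [set~ v] [:: (v, t v)] gt.
- by rewrite cardsC1 /= addn1 prednK //; apply/card_gt0P; exists v.
- by move=> x; rewrite finset.inE => /eqP ->.
split; first by apply: sub; rewrite finset.inE.
move=> e x w xZ ew ek; have := cl e x w xZ ew ek.
by rewrite !finset.inE orNb orbF.
Qed.

(** New queue entries are taken out of [U], so the union of [U] and the queue never grows, and only
    pairs inside it are examined. This is what separates later steps from the edges at processed
    vertices. *)
Lemma explore_local (f : nat) g h U s :
  (forall e : vpair V, {subset val e <= [predU U & unzip1 s]} -> g e = h e) ->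
  explore f g U s = explore f h U s.
Proof.
elim: f U s => [|f IH] U [|[u k] s] //= gh.
have X_eq : cnbrs g u k U = cnbrs h u k U.
  apply/finset.setP => w; rewrite !finset.inE; have [wU /=|//] := boolP (w \in U).
  apply: eq_existsb => e; have [ew /=|//] := eqVneq (val e) [set u; w].
  rewrite gh // => x; rewrite ew !finset.inE => /orP[]/eqP ->; rewrite ?wU ?eqxx //=.
  by rewrite orbT.
rewrite X_eq; congr (_ |: _); apply: IH => e esub; apply: gh => x /esub.
rewrite !finset.inE unzip1_cat_map mem_cat mem_enum finset.inE.
by case: (x \in U) => //=; rewrite orbF => ->; rewrite orbT.
Qed.

Lemma adapted_walk_forced (R : realType) (B : R) g :
  (forall v k, #|forced g v k|%:R <= B) ->
  forall s t : vcoloring V, adapted g s -> adapted g t -> adapted_walk g B s t.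
Proof.
move=> gB s t; move: {2}#|_|.+1 (ltnSn #|disagree s t|) => m.
elim: m s => // m IH s; rewrite ltnS => sm gs gt.
have [st0|[v vst]] := set_0Vmem (disagree s t).
  have st : s = t.
    apply/ffunP => v; apply/eqP/negbNE/negP => stv.
    by have := finset.in_set0 v; rewrite -st0 finset.inE stv.
  by exists [::]; split=> // r; rewrite finset.inE => /eqP ->.
have [vZ clZ] := forced_closed v gt; set Z := forced g v (t v) in vZ clZ.
pose s' : vcoloring V := [ffun x => if x \in Z then t x else s x].
have gs' : adapted g s'.
  move=> e u w k ew ek; have ewu : val e = [set w; u] by rewrite ew finset.setUC.
  have := gt e u w k ew ek; have := gs e u w k ew ek.
  (* Edges inside [Z] are handled by [t], edges outside by [s]. On a crossing edge the end in [Z]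
     cannot have the edge color, as closure would put the other end in [Z]. *)
  rewrite !ffunE; case: ifPn => uZ; case: ifPn => wZ // _ _.
    by left=> tu; rewrite (clZ e u w uZ ew) ?tu in wZ.
  by right=> tw; rewrite (clZ e w u wZ ewu) ?tw in uZ.
have lt_s' : (#|disagree s' t| < #|disagree s t|)%N.
  apply: proper_card; apply/fintype.properP; split.
    apply/fintype.subsetP => x; rewrite !finset.inE ffunE; case: ifP => // _.
    by rewrite eqxx.
  by exists v; rewrite // finset.inE ffunE vZ eqxx.
have [q [qt gq pq]] := IH s' (leq_trans lt_s' sm) gs' gt.
exists (s' :: q); split=> //=.
  by move=> r; rewrite in_cons => /predU1P[->|/gq].
rewrite pq andbT; apply: le_trans (gB v (t v)); rewrite ler_nat.
apply: fintype.subset_leq_card; apply/fintype.subsetP => x; rewrite finset.inE ffunE -/Z.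
by case: ifP => //; rewrite eqxx.
Qed.

End ForcedSet.

(** * Expectations over the random graph and the tail of forced set sizes *)

Section Expectation.
Variables (R : realType) (n : nat) (p : R).
Implicit Types (F H : ecgraph 'I_n -> R) (D : {set vpair 'I_n}).

Definition expect F : R := \sum_g Gnp2 p g * F g.

Lemma expect1 : expect (fun=> 1) = 1.
Proof.
rewrite -[RHS](Pr_Gnp2_setT n p) /expect /Pr_Gnp2.
by apply: eq_big => [g|g _]; rewrite ?asboolT ?mulr1.
Qed.

Lemma expectZ (c : R) F : expect (fun g => c * F g) = c * expect F.
Proof. by rewrite /expect mulr_sumr; apply: eq_bigr => g _; rewrite mulrCA. Qed.

Lemma expect_sum (I : finType) (P : pred I) (F : I -> ecgraph 'I_n -> R) :
  expect (fun g => \sum_(i | P i) F i g) = \sum_(i | P i) expect (F i).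
Proof. by rewrite /expect exchange_big; apply: eq_bigr => g _; rewrite mulr_sumr. Qed.

Lemma expect_prod (phi : vpair 'I_n -> option color -> R) :
  expect (fun g => \prod_e phi e (g e)) =
  \prod_e \sum_o pair_law p o * phi e o.
Proof. by rewrite bigA_distr_bigA; apply: eq_bigr => g _; rewrite big_split. Qed.

Lemma expect_le F H : 0 <= p <= 1 -> (forall g, F g <= H g) ->
  expect F <= expect H.
Proof.
by move=> p01 FH; apply: ler_sum => g _; apply: ler_wpM2l; rewrite ?Gnp2_ge0.
Qed.

(** Plays the role of measurability with respect to the states of the pairs in [D]. *)
Definition local D F : Prop :=
  forall g h : ecgraph 'I_n, (forall e, e \in D -> g e = h e) -> F g = F h.

(* Exchanging the coordinates in [D] between two independent copies of the
   random graph is a measure-preserving involution. *)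
Lemma expect_indep D F H : local D F -> local (~: D) H ->
  expect (fun g => F g * H g) = expect F * expect H.
Proof.
move=> FD HD.
pose mix (g h : ecgraph 'I_n) : ecgraph 'I_n :=
  [ffun e => if e \in D then g e else h e].
pose sw (x : ecgraph 'I_n * ecgraph 'I_n) := (mix x.1 x.2, mix x.2 x.1).
have swK : involutive sw.
  by move=> [g h]; rewrite /sw /=; congr pair; apply/ffunP => e;
    rewrite !ffunE; case: (e \in D).
(* The factor 1, written as an expectation, supplies the second independent copy. *)
rewrite -[LHS]mulr1 -expect1 /expect !big_distrlr /= !pair_bigA /=.
rewrite [RHS](reindex_inj (inv_inj swK)); apply: eq_bigr => -[g h] _ /=.
have -> : F (mix g h) = F g by apply: FD => e eD; rewrite ffunE eD.
have -> : H (mix h g) = H g.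
  by apply: HD => e; rewrite finset.inE ffunE => /negPf ->.
have : Gnp2 p (mix g h) * Gnp2 p (mix h g) = Gnp2 p g * Gnp2 p h.
  rewrite /Gnp2 -!big_split; apply: eq_bigr => e _ /=; rewrite !ffunE.
  by case: ifP => // _; rewrite mulrC.
by move=> mixE; ring: mixE.
Qed.

Lemma Pr_Gnp2_le (A B : ecgraph 'I_n -> Prop) : 0 <= p <= 1 ->
  (forall g, A g -> B g) -> Pr_Gnp2 p A <= Pr_Gnp2 p B.
Proof.
move=> p01 AB; rewrite /Pr_Gnp2 big_mkcond [leRHS]big_mkcond /=.
apply: ler_sum => g _; case: asboolP => [/AB ?|_]; first by rewrite asboolT.
by case: ifP => // _; rewrite Gnp2_ge0.
Qed.

Lemma Pr_Gnp2_C (A : ecgraph 'I_n -> Prop) :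
  Pr_Gnp2 p (fun g => ~ A g) = 1 - Pr_Gnp2 p A.
Proof.
rewrite -(Pr_Gnp2_setT n p) /Pr_Gnp2 [X in X - _](bigID (fun g => `[< A g >])) /=.
rewrite (eq_bigl (fun g => `[< A g >])); last by move=> g; rewrite asboolT.
by rewrite addrAC subrr add0r; apply: eq_bigl => g; rewrite asbool_neg (asboolT Logic.I).
Qed.

(** Markov's inequality: [F] dominates the indicator of [A]. *)
Lemma Pr_Gnp2_le_expect (A : ecgraph 'I_n -> Prop) F : 0 <= p <= 1 ->
  (forall g, 0 <= F g) -> (forall g, A g -> 1 <= F g) ->
  Pr_Gnp2 p A <= expect F.
Proof.
move=> p01 F0 F1; rewrite /Pr_Gnp2 /expect big_mkcond /=.
apply: ler_sum => g _; case: asboolP => [Ag|_].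
  by rewrite -[leLHS]mulr1; apply: ler_wpM2l; rewrite ?Gnp2_ge0 ?F1.
by rewrite mulr_ge0 ?Gnp2_ge0.
Qed.

(** The edges of color [k] at [u] come from at most [n] independent pairs, each with probability
    [p / 2]; then [1 + x <= expR x]. *)
Lemma expect_cnbrs_le (y : R) (u : 'I_n) (k : color) (U : {set 'I_n}) :
  0 <= p <= 1 -> 1 <= y -> u \notin U ->
  expect (fun g => y ^+ #|cnbrs g u k U|) <= expR (p / 2 * (y - 1) * n%:R).
Proof.
move=> p01 y1 uU; pose phi (e : vpair 'I_n) (o : option color) : R :=
  if (u \in val e) && (o == Some k) then y else 1.
apply: (@le_trans _ _ (expect (fun g => \prod_e phi e (g e)))).
  apply: expect_le => // g; rewrite /phi -big_mkcond /= prodr_const ler_weXn2l //.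
  have injX : {in cnbrs g u k U &, injective (fun w => [set u; w])}.
    move=> w w' /(fintype.subsetP (cnbrs_sub g u k U)) wU _ /finset.setP/(_ w).
    rewrite !finset.inE eqxx orbT; have [wu|_ /esym/eqP//] := eqVneq w u.
    by rewrite -wu wU in uU.
  rewrite -(card_in_imset injX).
  apply: (leq_trans _ (leq_imset_card (fun e : vpair 'I_n => val e) _)).
  apply: fintype.subset_leq_card; apply/fintype.subsetP => A /imsetP[w].
  rewrite finset.inE => /andP[_ /existsP[e /andP[/eqP ew ek]]] ->.
  by apply/imsetP; exists e => //; rewrite unfold_in ew finset.set21.
rewrite expect_prod expRM_natr.
have phiE e : \sum_o pair_law p o * phi e o =
    if u \in val e then 1 + p / 2 * (y - 1) else 1.
  rewrite (bigD1 None) //= (bigD1 (Some true)) //= (bigD1 (Some false)) //=.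
  rewrite big1 => [|[[]|]] //; rewrite /phi andbF.
  by case: (u \in val e) => //=; case: k {phi} => /=; field.
rewrite (eq_bigr _ (fun e _ => phiE e)) -big_mkcond prodr_const.
have q0 : 0 <= p / 2 * (y - 1).
  by case/andP: p01 => p0 _; rewrite mulr_ge0 ?divr_ge0 ?subr_ge0.
apply: (@le_trans _ _ ((1 + p / 2 * (y - 1)) ^+ n)); last first.
  by apply: lerXn2r; rewrite ?nnegrE ?expR_ge0 ?expR_ge1Dx ?addr_ge0.
apply: ler_weXn2l; first by rewrite lerDl.
rewrite -(card_imset _ val_inj) -[X in (_ <= X)%N](card_ord n).
apply: (leq_trans _ (leq_imset_card (fun w => [set u; w]) _)).
apply: fintype.subset_leq_card; apply/fintype.subsetP => A /imsetP[e].
rewrite unfold_in => ue ->; have {}ue : u \in val e by exact: ue.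
have /cards2P[a [b [_ eab]]] : #|val e| == 2%N by exact: valP e.
apply/imsetP; move: ue; rewrite eab !finset.inE => /orP[]/eqP ->.
  by exists b.
by exists a; rewrite // finset.setUC.
Qed.

(* The exploration is dominated by a branching process whose offspring
   generating function is at most [expR (p / 2 * n%:R * (y - 1))]. *)
Lemma expect_explore_le (y z : R) (f : nat) (U : {set 'I_n})
    (s : seq ('I_n * color)) :
  0 <= p <= 1 -> 1 <= y -> 1 <= z ->
  z * expR (p / 2 * (y - 1) * n%:R) <= y ->
  uniq (unzip1 s) -> {in unzip1 s, forall x, x \notin U} ->
  expect (fun g => z ^+ #|explore f g U s|) <= y ^+ size s.
Proof.
move=> p01 y1 z1 zy; elim: f U s => [|f IH] U s us sU.
  by under eq_fun do rewrite /= cards0 expr0; rewrite expect1 exprn_ege1.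
case: s us sU => [|[u k] s] us sU.
  by under eq_fun do rewrite /= cards0 expr0; rewrite expect1 exprn_ege1.
have y0 : 0 < y by apply: lt_le_trans y1.
have z0 : 0 < z by apply: lt_le_trans z1.
have /andP[us1 us2] : (u \notin unzip1 s) && uniq (unzip1 s) by [].
have uU : u \notin U by apply: sU; rewrite /= mem_head.
pose rest (X : {set 'I_n}) := s ++ [seq (w, ~~ k) | w <- enum X].
pose G (X : {set 'I_n}) g := z ^+ #|explore f g (U :\: X) (rest X)|.
pose I (X : {set 'I_n}) g : R := (cnbrs g u k U == X)%:R.
(* The current step reads only pairs at [u], and the rest of the exploration only pairs avoiding
   [u]; hence [I X] and [G X] are independent. *)
pose D : {set vpair 'I_n} := [set e : vpair 'I_n | u \in val e].
have ID X : local D (I X).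
  move=> g h gh; rewrite /I; congr ((_ == _)%:R); apply/finset.setP => w.
  rewrite !finset.inE; case: (w \in U) => //=; apply: eq_existsb => e.
  have [ew /=|//] := eqVneq (val e) [set u; w].
  by rewrite gh // finset.inE ew finset.set21.
have GD (X : {set 'I_n}) : X \subset U -> local (~: D) (G X).
  move=> XU g h gh; rewrite /G; congr (z ^+ #|pred_of_set _|).
  apply: explore_local => e eU; apply: gh; rewrite !finset.inE.
  apply/negP => /eU; rewrite !finset.inE (negPf uU) andbF /= unzip1_cat_map.
  rewrite mem_cat (negPf us1) mem_enum /= => /(fintype.subsetP XU).
  by rewrite (negPf uU).
have EG (X : {set 'I_n}) : X \subset U -> expect (G X) <= y ^+ (size s + #|X|).
  move=> XU.
  have -> : (size s + #|X| = size (rest X))%N by rewrite size_cat size_map -cardE.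
  have sXF x : x \in unzip1 s -> x \notin X.
    move=> xs; apply/negP => /(fintype.subsetP XU); apply/negP; apply: sU.
    by rewrite in_cons xs orbT.
  apply: IH; rewrite unzip1_cat_map.
    rewrite cat_uniq us2 enum_uniq andbT; apply/hasPn => x; rewrite mem_enum.
    by apply: contraTN; exact: sXF.
  move=> x; rewrite mem_cat mem_enum finset.inE => /orP[xs|-> //].
  by rewrite negb_and (sU x) ?orbT // in_cons xs orbT.
have ID0 X g : 0 <= I X g by rewrite ler0n.
(* Split by the set [X] discovered at this step; the factor [z] accounts for [u]. *)
apply: (@le_trans _ _ (expect (fun g =>
    z * \sum_(X : {set 'I_n} | X \subset U) I X g * G X g))).
  apply: expect_le => // g; set X0 := cnbrs g u k U.
  rewrite (bigD1 X0) /=; last exact: cnbrs_sub.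
  rewrite big1 => [|X /andP[_ XX0]]; last by rewrite /I eq_sym (negPf XX0) mul0r.
  rewrite addr0 /I eqxx mul1r /G -exprS; apply: ler_weXn2l => //.
  by rewrite -/X0 cardsU1 -add1n leq_add2r leq_b1.
rewrite expectZ expect_sum.
apply: (@le_trans _ _ (z * (y ^+ size s *
    expect (fun g => y ^+ #|cnbrs g u k U|)))); last first.
  rewrite mulrCA exprSr; apply: ler_wpM2l; first by rewrite exprn_ge0 // ltW.
  apply: le_trans zy; apply: ler_wpM2l; first exact: ltW.
  exact: expect_cnbrs_le.
apply: ler_wpM2l; first exact: ltW.
have -> : expect (fun g => y ^+ #|cnbrs g u k U|) =
    expect (fun g => \sum_(X : {set 'I_n} | X \subset U) y ^+ #|X| * I X g).
  rewrite /expect; apply: eq_bigr => g _; congr (_ * _).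
  rewrite (bigD1 (cnbrs g u k U)) /=; last exact: cnbrs_sub.
  rewrite big1 => [|X /andP[_ XX0]]; last by rewrite /I eq_sym (negPf XX0) mulr0.
  by rewrite /I eqxx mulr1 addr0.
rewrite expect_sum mulr_sumr; apply: ler_sum => X XU.
rewrite expectZ mulrA -exprD (expect_indep (ID X) (GD X XU)) mulrC.
apply: ler_wpM2r; last exact: EG.
by apply: sumr_ge0 => g _; rewrite mulr_ge0 ?Gnp2_ge0.
Qed.

(* Markov's inequality for [z ^+ #|forced g v k|], summed over [v] and [k]. *)
Lemma Pr_forced_gt (y z B : R) :
  0 <= p <= 1 -> 1 <= y -> 1 < z ->
  z * expR (p / 2 * (y - 1) * n%:R) <= y ->
  Pr_Gnp2 p (fun g : ecgraph 'I_n => exists v k, B < #|forced g v k|%:R) <=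
    2 * n%:R * y / expR (B * ln z).
Proof.
move=> p01 y1 z1 zy; have z0 : 0 < z by apply: lt_trans z1.
(* [expR (B * ln z)] is [z] to the real power [B]. *)
pose F (g : ecgraph 'I_n) :=
  (expR (B * ln z))^-1 * \sum_(x : 'I_n * color) z ^+ #|forced g x.1 x.2|.
have zX m : z ^+ m = expR (m%:R * ln z) by rewrite expRM_natl lnK.
apply: (@le_trans _ _ (expect F)).
  apply: Pr_Gnp2_le_expect => // g.
    rewrite mulr_ge0 ?invr_ge0 ?expR_ge0 //; apply: sumr_ge0 => x _.
    by rewrite exprn_ge0 // ltW.
  case=> v [k Bvk]; rewrite /F mulrC ler_pdivlMr ?expR_gt0 // mul1r.
  rewrite (bigD1 (v, k)) //=.
  apply: (@le_trans _ _ (z ^+ #|forced g v k|)); last first.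
    by rewrite lerDl; apply: sumr_ge0 => x _; rewrite exprn_ge0 // ltW.
  by rewrite zX ler_expR ler_wpM2r ?ln_ge0 ?ltW.
rewrite expectZ mulrC; apply: ler_wpM2r; first by rewrite invr_ge0 expR_ge0.
rewrite expect_sum; apply: (@le_trans _ _ (\sum_(x : 'I_n * color) y)).
  apply: ler_sum => -[v k] _; rewrite -[leRHS]expr1.
  apply: (@expect_explore_le y z #|'I_n| [set~ v] [:: (v, k)]) => //.
    exact: ltW.
  by move=> w; rewrite mem_seq1 => /eqP ->; rewrite !finset.inE eqxx.
by rewrite sumr_const card_prod card_ord card_bool -[leLHS]mulr_natr natrM; lra.
Qed.

End Expectation.

(** * Choice of constants and passage to the limit *)

Theorem theorem1p7 (R : realType) (eps : R) (eps_gt0 : 0 < eps)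
    (eps_le2 : eps <= 2) :
  exists C : R,
    whp_Gnp2 (fun n => (2 - eps) / n%:R)
      (fun n (g : ecgraph 'I_n) =>
        forall s t : vcoloring 'I_n, adapted g s -> adapted g t ->
          adapted_walk g (C * ln n%:R) s t).
Proof.
pose d := eps / 2; pose y := 1 + d; pose z := 1 + d ^+ 3.
have d0 : 0 < d by rewrite divr_gt0.
have z1 : 1 < z by rewrite ltrDl exprn_gt0.
have y1 : 1 <= y by rewrite lerDl ltW.
have lnz0 : 0 < ln z by exact: ln_gt0.
(* The failure probability is at most [2 * n * y / n ^ 2 = 2 * y / n], which is at most
   [4 * y / (n + 1)] since [n + 1 <= 2 * n]; [harmonic n] is [1 / (n + 1)]. *)
exists (2 / ln z); apply: (squeeze_cvgr (f := fun n => 1 - 4 * y * harmonic n)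
  (h := fun=> 1)); last exact: cvg_cst; last first.
  rewrite -[X in (_ --> X)%classic]subr0 -[X in 1 - X](mulr0 (4 * y)).
  by apply: cvgB; [exact: cvg_cst | apply: cvgMr; exact: cvg_harmonic].
(* From [n = 2] on, [2 - eps <= n] gives [p <= 1]. *)
exists 2%N => // n /= n2.
have n0 : 0 < n%:R :> R by rewrite ltr0n (leq_trans _ n2).
set p := (2 - eps) / n%:R.
have p01 : 0 <= p <= 1.
  rewrite divr_ge0 ?subr_ge0 ?ler0n //= ler_pdivrMr // mul1r.
  have : 2 <= n%:R :> R by rewrite ler_nat.
  by lra.
have zy : z * expR (p / 2 * (y - 1) * n%:R) <= y.
  have -> : p / 2 * (y - 1) * n%:R = (1 - d) * d.
    by rewrite /p /y /d; field; rewrite gt_eqF.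
  rewrite -ler_pdivlMr ?expR_gt0 // -expRN.
  (* Sum of cubes: [1 + d ^ 3 = (1 + d) * (1 - d + d ^ 2)]. *)
  have -> : z = y * (1 + - ((1 - d) * d)) by rewrite /z /y; ring.
  by apply: ler_wpM2l; rewrite ?expR_ge1Dx // (le_trans ler01).
set A := (X in Pr_Gnp2 _ X).
apply/andP; split; last first.
  by rewrite -(Pr_Gnp2_setT n p); apply: Pr_Gnp2_le.
pose B := 2 / ln z * ln n%:R.
apply: (@le_trans _ _ (1 - Pr_Gnp2 p (fun g : ecgraph 'I_n =>
    exists v k, B < #|forced g v k|%:R))).
  rewrite lerB //; apply: le_trans (Pr_forced_gt _ p01 y1 z1 zy) _.
  have -> : B * ln z = ln (n%:R ^+ 2).
    by rewrite lnXn // /B -mulr_natl; field; rewrite gt_eqF.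
  rewrite lnK ?posrE ?exprn_gt0 // /harmonic /=.
  rewrite ler_pdivrMr ?exprn_gt0 // [leRHS]mulrAC ler_pdivlMr ?ltr0n //.
  have -> : 4 * y * n%:R ^+ 2 = (2 * n%:R * y) * (2 * n%:R) by ring.
  rewrite ler_wpM2l ?mulr_ge0 ?(le_trans ler01 y1) ?ler0n //.
  by rewrite -natrM ler_nat; lia.
rewrite -Pr_Gnp2_C; apply: Pr_Gnp2_le => // g nB; apply: adapted_walk_forced => v k.
by rewrite leNgt; apply/negP => Bvk; apply: nB; exists v, k.
Qed.
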